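(* Let $H$ be a uniformly random directed hypergraph with degree sequence $((d_v^{\mathrm{out}},d_v^{\mathrm{in}})_{v\in V},(\delta_e^{\mathrm{tail}},\delta_e^{\mathrm{head}})_{e\in E})$, where $n=|V|$, and let $WS_n$ be its number of weak self-loops. Put $f(u,i) = \mathbf{1}_{\{u \geq i\}} \frac{u!}{(u-i)!}$ for $u,i\in\mathbb{N}$ (equal to $0$ if $u<i$). Then $$\mathbb{E}[WS_n] = |E| - \sum_{e \in E} \frac{(n\mathbb{E}[d_U^{\mathrm{out}}]-\delta_e^{\mathrm{tail}})!\,(n\mathbb{E}[d_U^{\mathrm{in}}]-\delta_e^{\mathrm{head}})!}{(n\mathbb{E}[d_U^{\mathrm{out}}])!\,(n\mathbb{E}[d_U^{\mathrm{in}}])!}\sum_{\substack{\mathbf{a} \in \mathbb{N}^{\delta_e^{\mathrm{tail}}}:\\ \sum_{i} ia_i = \delta_e^{\mathrm{tail}}}} \frac{\delta_e^{\mathrm{tail}}!}{\prod_{k=1}^{\delta_e^{\mathrm{tail}}} k!^{a_k}} \sum_{\substack{\mathbf{b} \in \mathbb{N}^{\delta_e^{\mathrm{head}}}:\\ \sum_{i} ib_i = \delta_e^{\mathrm{head}}}} \frac{\delta_e^{\mathrm{head}}!}{\prod_{k=1}^{\delta_e^{\mathrm{head}}} k!^{b_k}}$$ $$\times \sum_{\gamma \in \hat{R}(\mathbf{a},\mathbf{b})} (-1)^{\sum_{\mathbf{g} \in \mathbb{N}^{\delta_e^{\mathrm{tail}}},\, \mathbf{h} \in \mathbb{N}^{\delta_e^{\mathrm{head}}}}\left(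 \sum_{i=1}^{\delta_e^{\mathrm{tail}}} g_i + \sum_{j=1}^{\delta_e^{\mathrm{head}}} h_j -1\right) \gamma(\mathbf{g},\mathbf{h})}$$ $$\times\prod_{\substack{\mathbf{y} \in \mathbb{N}^{\delta_e^{\mathrm{tail}}}\\ \mathbf{z} \in \mathbb{N}^{\delta_e^{\mathrm{head}}}}} \left( \frac{1}{\gamma(\mathbf{y},\mathbf{z})!} \left(\frac{n\,\mathbb{E}\left[\prod_{i=1}^{\delta_e^{\mathrm{tail}}} \big(f(d_U^{\mathrm{out}},i)\big)^{y_i} \prod_{j=1}^{\delta_e^{\mathrm{head}}} \big(f(d_U^{\mathrm{in}} ,j)\big)^{z_j} \right] \left(\sum_{i=1}^{\delta_e^{\mathrm{tail}}} y_i + \sum_{j=1}^{\delta_e^{\mathrm{head}}}z_j-1 \right)!}{\prod_{i=1}^{\delta_e^{\mathrm{tail}}} y_i! \prod_{j=1}^{\delta_e^{\mathrm{head}}} z_j!} \right)^{\gamma(\mathbf{y},\mathbf{z})} \right).$$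
   Context: $\mathbb{N}$ contains $0$, and $0^0=1$. Let $V$ be a finite vertex set with $n=|V|$ and $E$ a finite set of (labelled) hyperedges. A directed degree sequence consists of vertex out- and in-degrees $d_v^{\mathrm{out}},d_v^{\mathrm{in}}\in\mathbb{N}$ ($v\in V$) and hyperedge tail- and head-degrees $\delta_e^{\mathrm{tail}},\delta_e^{\mathrm{head}}\in\mathbb{N}$ ($e\in E$) with $\sum_v d_v^{\mathrm{out}}=\sum_e\delta_e^{\mathrm{tail}}$ and $\sum_v d_v^{\mathrm{in}}=\sum_e\delta_e^{\mathrm{head}}$. A uniformly random (stub-labeled) directed hypergraph with this degree sequence is obtained as follows: each vertex $v$ has $d_v^{\mathrm{out}}$ distinguishable out-stubs and $d_v^{\mathrm{in}}$ distinguishable in-stubs; all out-stubs are distributed over the tails so that the tail of $e$ receives exactly $\delta_e^{\mathrm{tail}}$ out-stubs, and all in-stubs are distributed over the heads so that the head of $e$ receives exactly $\delta_e^{\mathrm{head}}$ in-stubs (slots within a tail or head are interchangeable); all such pairs of assignments are equally likely (so the out- and in-assignments are independent and uniform). Each hyperedge is then a pair $e=(e^{\mathrm{tail}},e^{\mathrm{head}})$ of multisets of vertices, where multiplicities count the stubs of a vertex in the tail and in the head. A hyperedge $e$ is a weak self-loop if some vertex $v$ belongs to both $e^{\mathrm{tail}}$ and $e^{\mathrm{head}}$; $WS_n$ is the number of weak self-loops. $U$ is a uniformly chosen vertex of $V$, with out-degree $d_U^{\mathrm{out}}$ and in-degree $d_U^{\mathrm{in}}$. For $\mathbf{a}\in\mathbb{N}^{\delta_1}$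 and $\mathbf{b}\in\mathbb{N}^{\delta_2}$, $\hat{R}(\mathbf{a},\mathbf{b})$ is the set of functions $\gamma:\mathbb{N}^{\delta_1}\times\mathbb{N}^{\delta_2}\to\mathbb{N}$ with $\gamma(\mathbf{0},\mathbf{0})=0$ such that $\sum_{\mathbf{y},\mathbf{z}}y_i\,\gamma(\mathbf{y},\mathbf{z})=a_i$ for all $i\in\{1,\dots,\delta_1\}$ and $\sum_{\mathbf{y},\mathbf{z}}z_j\,\gamma(\mathbf{y},\mathbf{z})=b_j$ for all $j\in\{1,\dots,\delta_2\}$ (sums over $\mathbf{y}\in\mathbb{N}^{\delta_1},\mathbf{z}\in\mathbb{N}^{\delta_2}$); it is used with $\delta_1=\delta_e^{\mathrm{tail}}$, $\delta_2=\delta_e^{\mathrm{head}}$. Factors of the product with $\gamma(\mathbf{y},\mathbf{z})=0$ (in particular $(\mathbf{0},\mathbf{0})$) are equal to $1$. *)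

(* Defs.v *)
From HB Require Import structures.
From mathcomp Require Import all_boot all_order all_algebra.
From mathcomp Require Import finmap multiset.
From mathcomp Require Import boolp classical_sets functions cardinality fsbigop reals.
Set Implicit Arguments.
Unset Strict Implicit.
Unset Printing Implicit Defensive.
Import Order.TTheory GRing.Theory Num.Theory.

Local Open Scope mset_scope.
Local Open Scope classical_set_scope.
Local Open Scope ring_scope.

(* Expectation of X under the uniform distribution on A. *)
Definition unif_expect (R : realType) (T : finType) (A : {set T}) (X : T -> R) : R :=
  (\sum_(t in A) X t) / #|A|%:R.

(* Factorial of a real number that is (the image of) a natural number. *)
Definition rfact (R : realType) (x : R) : R := ((Num.truncn x)`!)%:R.

Section RandomHypergraph.
Variables (V E : finType).

(* The stubs of v are the pairs (v, k) with k < d v. *)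
Definition stub (d : V -> nat) : finType := {v : V & 'I_(d v)}.

Definition stub_assignments (d : V -> nat) (delta : E -> nat) :
    {set {ffun stub d -> E}} :=
  [set phi : {ffun stub d -> E} |
    [forall e, #|[set s | phi s == e]%SET| == delta e]]%SET.

(* A stub-labelled directed hypergraph: the assignments of the out-stubs to
   the tails and of the in-stubs to the heads. *)
Definition stub_hypergraph (dout din : V -> nat) : finType :=
  ({ffun stub dout -> E} * {ffun stub din -> E})%type.

Definition stub_hypergraphs (dout din : V -> nat) (dtail dhead : E -> nat) :
    {set stub_hypergraph dout din} :=
  finset.setX (stub_assignments dout dtail) (stub_assignments din dhead).

Definition stub_owners (d : V -> nat) (phi : {ffun stub d -> E}) (e : E) :
    {mset V} :=
  seq_mset [seq tag s | s <- enum [set s | phi s == e]%SET].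

Section Hyperedges.
Variables (dout din : V -> nat) (H : stub_hypergraph dout din).

Definition hyperedge (e : E) : {mset V} * {mset V} :=
  (stub_owners H.1 e, stub_owners H.2 e).

Definition weak_self_loop (e : E) : bool :=
  [exists v : V, (v \in (hyperedge e).1) && (v \in (hyperedge e).2)].

Definition WS : nat := #|[set e | weak_self_loop e]%SET|.

End Hyperedges.
End RandomHypergraph.

Definition ff (R : realType) (u i : nat) : R :=
  if (i <= u)%N then u`!%:R / (u - i)`!%:R else 0.

(* NN^delta.  Coordinates are numbered from 0: [y i] is the coordinate with
   number i + 1 in the usual numbering 1, ..., delta. *)
Notation vecn delta := {ffun 'I_delta -> nat}.

(* The a in NN^delta with \sum_i i a_i = delta. *)
Definition type_vectors (delta : nat) : set (vecn delta) :=
  [set a : vecn delta | (\sum_(i < delta) i.+1 * a i)%N = delta].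
Arguments type_vectors : clear implicits.

(* The possibly infinite sum of the F t is s.  Finiteness of the support is
   required because the finitely supported big operator is 0 without it. *)
Definition has_nat_sum (T : choiceType) (F : T -> nat) (s : nat) : Prop :=
  finite_set [set t | F t != 0%N] /\ \big[addn/0%N]_(t \in [set: T]) F t = s.

Definition Rhat (d1 d2 : nat) (a : vecn d1) (b : vecn d2) :
    set (vecn d1 * vecn d2 -> nat) :=
  [set gamma : vecn d1 * vecn d2 -> nat |
    [/\ gamma ([ffun=> 0%N], [ffun=> 0%N]) = 0%N,
      forall i, has_nat_sum
        (fun yz : vecn d1 * vecn d2 => yz.1 i * gamma yz)%N (a i) &
      forall j, has_nat_sum
        (fun yz : vecn d1 * vecn d2 => yz.2 j * gamma yz)%N (b j)]].

(* \sum_i y_i + \sum_j z_j - 1.  The subtraction truncates at (0, 0) only,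
   where every element of Rhat vanishes. *)
Definition weight_pred (d1 d2 : nat) (yz : vecn d1 * vecn d2) : nat :=
  (\sum_(i < d1) yz.1 i + \sum_(j < d2) yz.2 j).-1.

(* Main.v *)
Require Import Defs.
From HB Require Import structures.
From mathcomp Require Import all_boot all_order all_algebra.
From mathcomp Require Import finmap multiset.
From mathcomp Require Import boolp classical_sets functions cardinality fsbigop reals.
From mathcomp Require Import ring.
Set Implicit Arguments.
Unset Strict Implicit.
Unset Printing Implicit Defensive.
Import Order.TTheory GRing.Theory Num.Theory.

(** By linearity of expectation the number of weak self-loops is [|E|] minus the
    sum over the hyperedges [e] of the probability that the tail and the head of
    [e] have no common vertex.  Write [p], [q] for the tail and head degree of
    [e] and [M], [N] for the total out- and in-degree.  Permuting the stubs
    shows that the set of out-stubs sent to the tail of [e] is uniform among the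
    ['C(M, p)] sets of size [p], and likewise for the head
    ([card_assignments]); so the probability is [D / ('C(M, p) * 'C(N, q))],
    where [D] counts the pairs of a [p]-set of out-stubs and a [q]-set of
    in-stubs without a common owner ([card_no_weak_self_loop]).

    Choosing the stubs vertex by vertex, where a vertex may supply out-stubs or
    in-stubs but not both, gives [D] as a coefficient of a product over the
    vertices ([card_disjoint_pairs]):
      [D = [x^p w^q] \prod_v (1 + \sum_i 'C(dout v, i) x^i
                                 + \sum_j 'C(din v, j) w^j)].
    With [F_v] for the sum of the two inner sums, the right-hand side of the
    theorem is obtained by rewriting this product as
      [\exp (\sum_v \ln (1 + F_v))].
    The multinomial theorem expands [\ln (1 + F_v)] into monomials indexed by
    the pairs [(y, z)] of exponent vectors, with coefficient
    [(-1)^(k-1) (k-1)! / (\prod y_i! \prod z_j!)] for [k = |y| + |z|]; summing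
    over [v] turns the monomials into the mixed moments of the degrees, and
    expanding the exponential of each term separately introduces the
    multiplicities [gamma (y, z)].  The vectors [a] and [b] record how often
    each [i] and each [j] occurs in total ([sum_by_type]).

    The identity [\exp (\ln (1 + F)) = 1 + F] is used for polynomials modulo
    ['X^(K+1)] with truncated series.  It is proved through logarithmic
    derivatives: two polynomials with the same constant term which satisfy the
    same equation [P' = L P] modulo ['X^K] agree up to degree [K]
    ([logder_inj]), and both sides satisfy such an equation ([exp_log]).  The
    same principle yields the multinomial theorem, from
    [\exp (s X) \exp (t X) = \exp ((s + t) X)].  To read off a coefficient in
    two variables, [x] and [w] are replaced by [xT] and [T], so that [T]
    measures the total degree and the wanted monomial is [x^p T^(p+q)].

    The vectors [a], [b], [y], [z] and the functions [gamma] range over infinite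
    types, but all relevant entries and values are at most [p + q]; the sums are
    rewritten as sums over functions into an ordinal ([type_vectors_sum], [Rhat_sum]). *)

Local Open Scope ring_scope.

(** * Truncated exponentials and logarithms *)

(** [P] has a zero of order at least [K] at the origin; calculating modulo
    ['X^K] means that a difference is [ordge K]. *)
Definition ordge (A : comNzRingType) (K : nat) (P : {poly A}) : Prop :=
  exists Q, P = Q * 'X^K.

Section Ordge.
Variable A : comNzRingType.
Implicit Types P Q L : {poly A}.

Lemma ordgeD K P Q : ordge K P -> ordge K Q -> ordge K (P + Q).
Proof. by move=> [D ->] [D' ->]; exists (D + D'); rewrite mulrDl. Qed.

Lemma ordgeMl K P Q : ordge K P -> ordge K (Q * P).
Proof. by move=> [D ->]; exists (Q * D); rewrite mulrA. Qed.

Lemma ordgeMr K P Q : ordge K P -> ordge K (P * Q).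
Proof. by rewrite mulrC; apply: ordgeMl. Qed.

Lemma ordgeN K P : ordge K P -> ordge K (- P).
Proof. by rewrite -mulN1r; apply: ordgeMl. Qed.

Lemma ordge0 K : ordge K (0 : {poly A}).
Proof. by exists 0; rewrite mul0r. Qed.

Lemma ordge0n P : ordge 0 P.
Proof. by exists P; rewrite expr0 mulr1. Qed.

Lemma ordgeW K K' P : (K' <= K)%N -> ordge K P -> ordge K' P.
Proof.
by move=> /subnK <- [D ->]; exists (D * 'X^(K - K')); rewrite -mulrA -exprD.
Qed.

Lemma ordge_sum K (I : finType) (r : pred I) (P : I -> {poly A}) :
  (forall i, r i -> ordge K (P i)) -> ordge K (\sum_(i | r i) P i).
Proof.
by move=> h; apply: big_ind => //; [exact: ordge0 | move=> ? ?; exact: ordgeD].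
Qed.

Lemma ordgeM K K' P Q : ordge K P -> ordge K' Q -> ordge (K + K') (P * Q).
Proof. by move=> [D ->] [D' ->]; exists (D * D'); rewrite exprD; ring. Qed.

Lemma ordgeX K n P : ordge K P -> ordge (K * n) (P ^+ n).
Proof. by move=> [D ->]; exists (D ^+ n); rewrite exprMn -exprM. Qed.

Lemma ordge_prod (I : finType) (K : I -> nat) (P : I -> {poly A}) :
  (forall i, ordge (K i) (P i)) -> ordge (\sum_i K i) (\prod_i P i).
Proof.
move=> h; elim/big_rec2: _ => [|i k Q _]; first by exists 1; rewrite mul1r.
exact: ordgeM.
Qed.

Lemma coef_ordge K P k : ordge K P -> (k < K)%N -> P`_k = 0.
Proof. by move=> [D ->] kK; rewrite coefMXn kK. Qed.

Lemma ordge_deriv K P : ordge K.+1 P -> ordge K P^`().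
Proof.
move=> [D ->]; exists (D^`() * 'X + D *+ K.+1).
by rewrite derivM derivXn /= exprS mulrDl mulrnAr mulrnAl mulrA.
Qed.

(** [L] is the logarithmic derivative of [P] modulo ['X^K], without dividing by
    [P]. *)
Definition logder K P L := ordge K (P^`() - L * P).

Lemma logderM K P Q L M :
  logder K P L -> logder K Q M -> logder K (P * Q) (L + M).
Proof.
move=> hP hQ; rewrite /logder derivM.
suff -> : P^`() * Q + P * Q^`() - (L + M) * (P * Q) =
  (P^`() - L * P) * Q + P * (Q^`() - M * Q) by apply: ordgeD;
  [apply: ordgeMr | apply: ordgeMl].
by ring.
Qed.

Lemma logder_prod K (I : finType) (r : pred I) (P L : I -> {poly A}) :
  (forall i, r i -> logder K (P i) (L i)) ->
  logder K (\prod_(i | r i) P i) (\sum_(i | r i) L i).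
Proof.
move=> h; elim/big_rec2: _ => [|i k Q ri]; last by apply: logderM; exact: h.
by rewrite /logder derivC mul0r subr0; exact: ordge0.
Qed.

Lemma logder_eq K P L M : ordge K (L - M) -> logder K P L -> logder K P M.
Proof.
move=> hLM h; rewrite /logder.
suff -> : P^`() - M * P = (P^`() - L * P) + (L - M) * P
  by apply: ordgeD => //; apply: ordgeMr.
by ring.
Qed.

End Ordge.

Section TruncatedExp.
Variables (F : numFieldType) (A : comNzRingType) (iota : {rmorphism F -> A}).

(** A ring that receives the rational numbers has no torsion; this is all that
    solving a differential equation coefficientwise requires. *)
Lemma mulrSn_eq0 (x : A) n : x *+ n.+1 = 0 -> x = 0.
Proof.
move=> h; rewrite -[x]mul1r -(rmorph1 iota) -(@mulVf F n.+1%:R) ?pnatr_eq0 //.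
by rewrite rmorphM rmorph_nat -mulrA mulr_natl h mulr0.
Qed.

(** The difference [D] of the two solutions satisfies [D' = L D] modulo ['X^K] and
    [D`_0 = 0]; comparing coefficients, [(k+1) D`_(k+1)] is a combination of
    [D`_0], ..., [D`_k], so all of them vanish in turn. *)
Lemma logder_inj K (P Q L : {poly A}) :
  logder K P L -> logder K Q L -> P`_0 = Q`_0 ->
  forall k, (k <= K)%N -> P`_k = Q`_k.
Proof.
move=> hP hQ h0.
have h : logder K (P - Q) L.
  rewrite /logder derivB.
  suff -> : P^`() - Q^`() - L * (P - Q) =
    (P^`() - L * P) - (Q^`() - L * Q) by apply: ordgeD => //; apply: ordgeN.
  by ring.
move=> k kK; apply/eqP; rewrite -subr_eq0 -coefB; apply/eqP.
elim/ltn_ind: k kK => -[|k] IH kK; first by rewrite coefB h0 subrr.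
apply: (@mulrSn_eq0 _ k); rewrite -coef_deriv.
have := coef_ordge h kK; rewrite coefB => /eqP; rewrite subr_eq0 => /eqP ->.
rewrite coefM big1 // => i _; rewrite IH ?mulr0 // ?ltnS ?leq_subr //.
by rewrite (leq_trans (leq_subr _ _)) // ltnW.
Qed.

(** The exponential series up to degree [K]; [iota] lets rational scalars act,
    so that the ring of coefficients need not have inverses. *)
Definition texp K (c : A) : A := \sum_(k < K.+1) iota k`!%:R^-1 * c ^+ k.

(** Expanding a product of truncated exponentials: this is where the factorials
    of an exponent vector come from. *)
Lemma prod_texp (I : finType) (K : nat) (s : I -> A) :
  \prod_i texp K (s i) = \sum_(y : {ffun I -> 'I_K.+1})
    (\prod_i iota (y i)`!%:R^-1) * \prod_i s i ^+ y i.
Proof.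
rewrite /texp bigA_distr_bigA /=; apply: eq_bigr => y _.
by rewrite big_split.
Qed.

End TruncatedExp.

Section TruncatedExpPoly.
Variables (F : numFieldType) (A : comNzRingType) (iota : {rmorphism F -> A}).
Local Notation iotaP := (polyC \o iota : {rmorphism F -> {poly A}}).

Lemma texp_coef0 K (c : {poly A}) : ordge 1 c -> (texp iotaP K c)`_0 = 1.
Proof.
move=> hc; rewrite /texp big_ord_recl coefD /= fact0 invr1 rmorph1 mul1r coefC.
rewrite coef_sum big1 ?addr0 // => i _.
by apply: (@coef_ordge _ 1) => //; rewrite exprS; apply/ordgeMl/ordgeMr.
Qed.

Lemma deriv_texp K (c : {poly A}) :
  (texp iotaP K.+1 c)^`() = c^`() * texp iotaP K c.
Proof.
rewrite /texp raddf_sum big_ord_recl /= fact0 expr0 mulr1 derivC add0r mulr_sumr.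
apply: eq_bigr => i _; rewrite /= derivM derivC mul0r add0r deriv_exp /bump /=.
rewrite add1n; have e : iotaP i.+1`!%:R^-1 * i.+1%:R = iotaP i`!%:R^-1.
  rewrite -(rmorph_nat iotaP) -rmorphM factS natrM invfM mulrAC mulVf ?mul1r //.
  by rewrite pnatr_eq0.
move: e; rewrite -mulr_natl /= => <-; ring.
Qed.

(** The derivative of the truncated exponential misses one term,
    [c' c^K / K!], which has order at least [K]. *)
Lemma logder_texp K (c : {poly A}) :
  ordge 1 c -> logder K (texp iotaP K c) c^`().
Proof.
move=> hc; case: K => [|K]; first exact: ordge0n.
rewrite /logder deriv_texp -mulrBr; apply: ordgeMl.
suff -> : texp iotaP K c - texp iotaP K.+1 c = - (iotaP K.+1`!%:R^-1 * c ^+ K.+1).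
  by apply/ordgeN/ordgeMl; rewrite -[X in ordge X]mul1n; exact: ordgeX.
by rewrite /texp [\sum_(k < K.+2) _]big_ord_recr /= opprD addrA subrr add0r.
Qed.

End TruncatedExpPoly.

(** Truncated geometric series for [x' / (1 + x)]. *)
Lemma logder_1D (A : comNzRingType) K (x : {poly A}) : ordge 1 x ->
  logder K (1 + x) (x^`() * \sum_(k < K) (- x) ^+ k).
Proof.
move=> hx; rewrite /logder derivD derivC add0r.
have -> : x^`() - x^`() * (\sum_(k < K) (- x) ^+ k) * (1 + x) =
   x^`() * (- x) ^+ K.
  have := subrX1 (- x) K; set s := \sum_(k < K) _ => h.
  by rewrite -[(- x) ^+ K](subrK 1) h; ring.
apply: ordgeMl; rewrite -[X in ordge X]mul1n; apply: ordgeX; exact: ordgeN.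
Qed.

Lemma coef0_prod1 (A : comNzRingType) (I : finType) (r : pred I) (P : I -> {poly A}) :
  (forall i, r i -> (P i)`_0 = 1) -> (\prod_(i | r i) P i)`_0 = 1.
Proof.
move=> h; elim/big_rec: _ => [|i Q ri Q1]; first by rewrite coefC.
by rewrite coefM big_ord1 /= h // Q1 mulr1.
Qed.

Section Multinomial.
Variables (F : numFieldType) (A : comNzRingType) (iota : {rmorphism F -> A}).
Local Notation iotaP := (polyC \o iota : {rmorphism F -> {poly A}}).

(** Coefficient of ['X^k] in the identity between the product of the
    exponentials of [s i 'X] and [t j 'X] and the exponential of their sum.  The
    two families stay separate because the exponent vectors of the theorem come
    in pairs. *)
Lemma multinomial_pair (I J : finType) (K k : nat) (s : I -> A) (t : J -> A) :
  (k <= K)%N ->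
  \sum_(yz : {ffun I -> 'I_K.+1} * {ffun J -> 'I_K.+1} |
        (\sum_i yz.1 i + \sum_j yz.2 j == k)%N)
     ((\prod_i iota (yz.1 i)`!%:R^-1) * (\prod_i s i ^+ yz.1 i)) *
     ((\prod_j iota (yz.2 j)`!%:R^-1) * (\prod_j t j ^+ yz.2 j)) =
  iota k`!%:R^-1 * (\sum_i s i + \sum_j t j) ^+ k.
Proof.
move=> kK.
(* An auxiliary variable ['X] makes the sum over [y] a truncated series. *)
pose P := (\prod_i texp iotaP K ((s i)%:P * 'X)) *
          (\prod_j texp iotaP K ((t j)%:P * 'X)).
pose Q := texp iotaP K ((\sum_i s i + \sum_j t j)%:P * 'X).
have oX (a : A) : ordge 1 (a%:P * 'X) by exists a%:P.
have PQ : P`_k = Q`_k.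
  apply: (@logder_inj _ _ iota K P Q (\sum_i s i + \sum_j t j)%:P) => //.
  - rewrite polyCD !rmorph_sum /=.
    have dX (a : A) : logder K (texp iotaP K (a%:P * 'X)) a%:P.
      have := @logder_texp _ _ iota K _ (oX a).
      by rewrite derivM derivC mul0r add0r derivX mulr1.
    by apply: logderM; apply: logder_prod => i _; exact: dX.
  - have := @logder_texp _ _ iota K _ (oX (\sum_i s i + \sum_j t j)).
    by rewrite derivM derivC mul0r add0r derivX mulr1.
  - rewrite texp_coef0 // coefM big_ord1 /= !coef0_prod1 ?mulr1 // => i _;
    exact: texp_coef0.
have Qk : Q`_k = iota k`!%:R^-1 * (\sum_i s i + \sum_j t j) ^+ k.
  rewrite /Q /texp coef_sum (bigD1 (inord k)) //= inordK ?ltnS // [X in _ + X]big1.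
    by rewrite addr0 exprMn -polyC_exp !coefCM coefXn eqxx mulr1.
  move=> i ik; rewrite exprMn -polyC_exp coefCM coefCM coefXn.
  case: eqP => [ki|]; last by rewrite !mulr0.
  by case/eqP: ik; apply: val_inj; rewrite /= inordK.
rewrite -Qk -PQ /P !prod_texp big_distrlr /= pair_big /= coef_sum.
rewrite [RHS](bigID (fun yz : {ffun I -> 'I_K.+1} * {ffun J -> 'I_K.+1} =>
   (\sum_i yz.1 i + \sum_j yz.2 j == k)%N)) /=.
have E (yz : {ffun I -> 'I_K.+1} * {ffun J -> 'I_K.+1}) :
  ((\prod_i (iota (yz.1 i)`!%:R^-1)%:P) *
    (\prod_i ((s i)%:P * 'X) ^+ yz.1 i) *
   ((\prod_j (iota (yz.2 j)`!%:R^-1)%:P) *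
    (\prod_j ((t j)%:P * 'X) ^+ yz.2 j)))`_k =
  (((\prod_i iota (yz.1 i)`!%:R^-1) * (\prod_i s i ^+ yz.1 i)) *
     ((\prod_j iota (yz.2 j)`!%:R^-1) * (\prod_j t j ^+ yz.2 j))) *
  (k == \sum_i yz.1 i + \sum_j yz.2 j)%N%:R.
  have H (L : finType) (u : L -> A) (y : {ffun L -> 'I_K.+1}) :
    (\prod_i (iota (y i)`!%:R^-1)%:P) *
    (\prod_i ((u i)%:P * 'X) ^+ y i) =
    ((\prod_i iota (y i)`!%:R^-1) * (\prod_i u i ^+ y i))%:P *
     'X^(\sum_i y i).
    rewrite polyCM !rmorph_prod /= -mulrA; congr (_ * _).
    rewrite -prodrXr -big_split /=; apply: eq_bigr => i _.
    by rewrite exprMn polyC_exp.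
  by rewrite !H mulrACA -exprD -polyCM coefCM coefXn.
rewrite [X in _ + X]big1 ?addr0; last first.
  by move=> yz nk; rewrite E eq_sym (negbTE nk) mulr0.
by apply: eq_bigr => yz yzk; rewrite E eq_sym yzk mulr1.
Qed.

End Multinomial.

Section ExpLog.
Variables (F : numFieldType) (A : comNzRingType) (iota : {rmorphism F -> A}).
Local Notation iotaP := (polyC \o iota : {rmorphism F -> {poly A}}).
Variables (V I J : finType) (K : nat).
Variables (X : V -> I -> {poly A}) (Y : V -> J -> {poly A}).
Local Notation box := ({ffun I -> 'I_K.+1} * {ffun J -> 'I_K.+1})%type.

Definition weight (yz : box) : nat := (\sum_i yz.1 i + \sum_j yz.2 j)%N.

(** The coefficient of [s^y t^z] in the expansion of
    [\ln (1 + \sum_i s_i + \sum_j t_j)]. *)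
Definition log_coef (yz : box) : F :=
  (-1) ^+ (weight yz).-1 * (weight yz).-1`!%:R /
  ((\prod_i (yz.1 i)`!%:R) * \prod_j (yz.2 j)`!%:R).

Definition log_term (yz : box) : {poly A} :=
  iotaP (log_coef yz) *
  \sum_v (\prod_i X v i ^+ yz.1 i) * (\prod_j Y v j ^+ yz.2 j).

Hypothesis X1 : forall v i, ordge 1 (X v i).
Hypothesis Y1 : forall v j, ordge 1 (Y v j).
Local Notation x v := (\sum_i X v i + \sum_j Y v j).

Lemma ordge_x v : ordge 1 (x v).
Proof. by apply: ordgeD; apply: ordge_sum => i _. Qed.

Lemma ordge_log_term yz : ordge (weight yz) (log_term yz).
Proof.
apply/ordgeMl/ordge_sum => v _; apply: ordgeM; apply: ordge_prod => i.
  by rewrite -[X in ordge X]mul1n; apply: ordgeX.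
by rewrite -[X in ordge X]mul1n; apply: ordgeX.
Qed.

(** [\sum_v \ln (1 + x v)], truncated. *)
Definition log_sum : {poly A} :=
  \sum_v \sum_(l < K) iotaP ((-1) ^+ l / l.+1%:R) * x v ^+ l.+1.

Lemma deriv_log_sum :
  log_sum^`() = \sum_v (x v)^`() * \sum_(l < K) (- x v) ^+ l.
Proof.
rewrite raddf_sum; apply: eq_bigr => v _; rewrite raddf_sum mulr_sumr.
apply: eq_bigr => l _; rewrite /= derivM derivC mul0r add0r deriv_exp /=.
have -> : (iota ((-1) ^+ l / l.+1%:R))%:P = (-1) ^+ l * iotaP l.+1%:R^-1.
  by rewrite -[LHS]/(iotaP _) rmorphM rmorphXn rmorphN1.
have e : iotaP l.+1%:R^-1 * l.+1%:R = 1.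
  by rewrite -(rmorph_nat iotaP) -rmorphM mulVf ?rmorph1 ?pnatr_eq0.
move: (x v) ((x v)^`()) => u w; rewrite (exprNn u) -(mulr_natl (w * _)).
transitivity ((iotaP l.+1%:R^-1 * l.+1%:R) * (w * ((-1) ^+ l * u ^+ l))).
  by ring.
by rewrite e mul1r.
Qed.

(** The homogeneous part of degree [l + 1] of the logarithm is
    [(-1)^l / (l+1) * x^(l+1)], by the multinomial theorem. *)
Lemma log_term_low (l : 'I_K) :
  \sum_(yz : box | weight yz == l.+1) log_term yz =
  \sum_v iotaP ((-1) ^+ l / l.+1%:R) * x v ^+ l.+1.
Proof.
rewrite /log_term.
under eq_bigr do rewrite mulr_sumr.
rewrite exchange_big /=; apply: eq_bigr => v _.
have -> : (-1) ^+ l / l.+1%:R = (-1) ^+ l * l`!%:R * l.+1`!%:R^-1 :> F.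
  rewrite -mulrA factS natrM invfM [_ * (_ / _)]mulrCA mulfV ?mulr1 //.
  by rewrite pnatr_eq0 -lt0n fact_gt0.
rewrite -[iota _]/(_) -[(iota _)%:P]/(iotaP _) rmorphM -mulrA.
rewrite -(multinomial_pair iotaP (X v) (Y v) (ltn_ord l)) mulr_sumr.
apply: eq_bigr => yz /eqP wyz; rewrite /log_coef wyz /=.
rewrite -[(iota _)%:P]/(iotaP _) invfM !rmorphM.
rewrite -!(prodfV, rmorph_prod) /=; ring.
Qed.

(** The terms of weight above [K] are present in the box but have too high an
    order to matter. *)
Lemma sum_log_term :
  ordge K.+1 (\sum_(yz : box | weight yz != 0%N) log_term yz - log_sum).
Proof.
rewrite (bigID (fun yz => weight yz <= K)%N) /= addrAC; apply: ordgeD; last first.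
  apply: ordge_sum => yz /andP[_]; rewrite -ltnNge => h.
  exact: ordgeW h (ordge_log_term yz).
case: (posnP K) => [K0|K0].
  rewrite big1 /log_sum; last first.
    by move=> yz /andP[]; rewrite [X in (_ <= X)%N]K0 leqn0 => /negbTE ->.
  rewrite add0r; apply: ordgeN; rewrite big1; first exact: ordge0.
  by move=> v _; apply: big1 => l; have := ltn_ord l; rewrite [X in (_ < X)%N]K0.
have PK : (K.-1.+1 = K)%N by rewrite prednK.
rewrite (partition_big (fun yz => cast_ord PK (inord (weight yz).-1)) predT) //=.
rewrite /log_sum exchange_big -sumrB /=; apply: ordge_sum => l _.
rewrite -log_term_low; set s1 := \sum_(_ | _) _; set s2 := \sum_(_ | _) _.
suff -> : s1 = s2 by rewrite subrr; exact: ordge0.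
apply: eq_bigl => yz; apply/idP/idP.
  case/andP => /andP[w0 wK] /eqP/(congr1 val) /= <-.
  by rewrite inordK ?prednK // lt0n.
move/eqP => w; rewrite w /= ltn_ord /=; apply/eqP/val_inj => /=.
by rewrite inordK ?prednK.
Qed.

(** Both sides have the logarithmic derivative of [log_sum] and constant
    term 1. *)
Theorem exp_log k : (k <= K)%N ->
  (\prod_(yz : box | weight yz != 0%N) texp iotaP K (log_term yz))`_k =
  (\prod_v (1 + x v))`_k.
Proof.
have o1 yz : weight yz != 0%N -> ordge 1 (log_term yz).
  by rewrite -lt0n => h; apply: ordgeW h (ordge_log_term yz).
apply: (@logder_inj _ _ iota K _ _ (\sum_v (x v)^`() * \sum_(l < K) (- x v) ^+ l)).
- apply: logder_eq; last first.
    by apply: logder_prod => yz h; apply: logder_texp; apply: o1.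
  rewrite -deriv_log_sum -raddf_sum -derivB; apply: ordge_deriv.
  exact: sum_log_term.
- by apply: logder_prod => v _; apply/logder_1D/ordge_x.
- rewrite !coef0_prod1 // => [yz h|v _]; first exact/texp_coef0/o1.
  by rewrite coefD coefC (coef_ordge (ordge_x v)) // addr0.
Qed.

End ExpLog.

(** * Extracting a coefficient in two variables *)

Section Monomial.
Variable F : comNzRingType.

(** The monomial [c x^a T^b], with [T] the outer variable. *)
Definition bimon (c : F) (a b : nat) : {poly {poly F}} := (c *: 'X^a)%:P * 'X^b.

Lemma bimonM c a b c' a' b' :
  bimon c a b * bimon c' a' b' = bimon (c * c') (a + a')%N (b + b')%N.
Proof.
rewrite /bimon mulrACA -polyCM -exprD; congr (polyC _ * _).
by rewrite -scalerAl -scalerAr scalerA exprD.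
Qed.

Lemma bimon1 : bimon 1 0 0 = 1.
Proof. by rewrite /bimon !expr0 scale1r mulr1. Qed.

Lemma bimonX c a b n : bimon c a b ^+ n = bimon (c ^+ n) (a * n)%N (b * n)%N.
Proof.
elim: n => [|n IH]; first by rewrite !expr0 !muln0 bimon1.
by rewrite exprS IH bimonM -exprS !mulnS.
Qed.

Lemma bimon_prod (I : finType) (r : pred I) (c : I -> F) (a b : I -> nat) :
  \prod_(i | r i) bimon (c i) (a i) (b i) =
  bimon (\prod_(i | r i) c i) (\sum_(i | r i) a i)%N (\sum_(i | r i) b i)%N.
Proof.
rewrite /bimon big_split -rmorph_prod prodrXr scaler_prod.
by rewrite -[X in (_ *: X)%:P]prodrXr.
Qed.

Lemma bimonD c c' a b : bimon (c + c') a b = bimon c a b + bimon c' a b.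
Proof. by rewrite /bimon scalerDl polyCD mulrDl. Qed.

Lemma bimon_sum (I : finType) (r : pred I) (c : I -> F) a b :
  \sum_(i | r i) bimon (c i) a b = bimon (\sum_(i | r i) c i) a b.
Proof.
elim/big_rec2: _ => [|i y x ri ->]; last by rewrite bimonD.
by rewrite /bimon scale0r polyC0 mul0r.
Qed.

Lemma bimonC c : bimon c 0 0 = c%:P%:P.
Proof. by rewrite /bimon !expr0 mulr1 alg_polyC. Qed.

Lemma coef_bimon c a b k l :
  (bimon c a b)`_k`_l = c * ((a == l) && (b == k))%:R.
Proof.
rewrite /bimon coefCM coefXn eq_sym [a == l]eq_sym; case: (b == k).
  by rewrite mulr1 coefZ coefXn andbT.
by rewrite mulr0 coef0 andbF mulr0.
Qed.

End Monomial.

Section CoefExpLog.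
Variables (F : numFieldType) (V : finType) (p q : nat).
Variables (alpha : V -> 'I_p -> F) (beta : V -> 'I_q -> F).
Let K := (p + q)%N.
Local Notation box := ({ffun 'I_p -> 'I_K.+1} * {ffun 'I_q -> 'I_K.+1})%type.

Definition degl (yz : box) : nat := (\sum_(i < p) i.+1 * yz.1 i)%N.
Definition degr (yz : box) : nat := (\sum_(j < q) j.+1 * yz.2 j)%N.

Definition vertex_sum (yz : box) : F :=
  \sum_v (\prod_i alpha v i ^+ yz.1 i) * (\prod_j beta v j ^+ yz.2 j).

(** With [alpha] and [beta] the binomial coefficients of the out- and in-degrees,
    this is the generating function of the selections of stubs in which each
    vertex supplies at most [p] out-stubs or at most [q] in-stubs, but not both
    kinds; [x] counts the out-stubs and [T] all stubs. *)
Definition vertex_poly : {poly {poly F}} :=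
  \prod_v (1 + (\sum_(i < p) bimon (alpha v i) i.+1 i.+1 +
                \sum_(j < q) bimon (beta v j) 0 j.+1)).

(** Expanding every exponential on the left of [exp_log], a choice of
    multiplicities [g] contributes a single monomial, whose exponents are the
    weighted sums of [g]; the coefficient of [x^p T^(p+q)] keeps exactly those
    [g] with the prescribed degrees. *)
Lemma sum_gamma_coef :
  \sum_(g : {ffun box -> 'I_K.+1} |
      [&& [forall yz, (weight yz == 0%N) ==> (g yz == ord0)],
          (\sum_yz degl yz * g yz == p)%N & (\sum_yz degr yz * g yz == q)%N])
    \prod_yz ((g yz)`!%:R^-1 * (log_coef F yz * vertex_sum yz) ^+ g yz) =
  vertex_poly`_(p + q)`_p.
Proof.
pose X v (i : 'I_p) := bimon (alpha v i) i.+1 i.+1.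
pose Y v (j : 'I_q) := bimon (beta v j) 0 j.+1.
have X1 v i : ordge 1 (X v i).
  by apply: (@ordgeW _ i.+1) => //; eexists.
have Y1 v i : ordge 1 (Y v i).
  by apply: (@ordgeW _ i.+1) => //; eexists.
have := @exp_log F {poly F} polyC V 'I_p 'I_q K X Y X1 Y1 K (leqnn K).
rewrite -/K -/vertex_poly => <-.
have LT (yz : box) : log_term polyC X Y yz =
    bimon (log_coef F yz * vertex_sum yz) (degl yz) (degl yz + degr yz)%N.
  rewrite /log_term /= -bimonC -[degl yz]add0n -[(_ + degr yz)%N]add0n.
  rewrite -bimonM; congr (_ * _); rewrite -bimon_sum; apply: eq_bigr => v _.
  rewrite -[degl yz in RHS]addn0 -addnA add0n -bimonM; congr (_ * _).
    rewrite addn0 /degl -bimon_prod; apply: eq_bigr => i _; exact: bimonX.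
  have -> : 0%N = (\sum_(j < q) 0 * yz.2 j)%N by rewrite big1.
  rewrite /degr -bimon_prod; apply: eq_bigr => i _; exact: bimonX.
have texpE (yz : box) : texp (polyC \o polyC) K (log_term polyC X Y yz) =
    \sum_(k < K.+1) bimon (k`!%:R^-1 * (log_coef F yz * vertex_sum yz) ^+ k)
        (degl yz * k)%N ((degl yz + degr yz) * k)%N.
  by apply: eq_bigr => k _; rewrite LT bimonX /= -bimonC bimonM !add0n.
rewrite [in RHS](eq_bigr _ (fun yz _ => texpE yz)).
rewrite (big_distr_big ord0) /= coef_sum coef_sum.
rewrite [RHS](bigID (fun g : {ffun box -> 'I_K.+1} =>
  (\sum_yz degl yz * g yz == p)%N && (\sum_yz degr yz * g yz == q)%N)) /=.
have supp (g : {ffun box -> 'I_K.+1}) (d : box -> nat) :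
    g \in pffun_on ord0 (fun yz => weight yz != 0%N) predT ->
  (\sum_(yz | weight yz != 0) d yz * g yz = \sum_yz d yz * g yz)%N.
  move=> /pffun_onP[/supportP h _]; rewrite big_mkcond; apply: eq_bigr => yz _.
  by case: ifP => // w; rewrite h ?muln0 //= -topredE /= w.
(* The outer exponent is the total degree, so the two conditions on the monomial
   are equivalent to the two conditions on [g]. *)
have degD (g : {ffun box -> 'I_K.+1}) :
  (\sum_yz (degl yz + degr yz) * g yz =
   \sum_yz degl yz * g yz + \sum_yz degr yz * g yz)%N.
  by rewrite -big_split; apply: eq_bigr => yz _; rewrite mulnDl.
rewrite [X in _ + X]big1 ?addr0; last first.
  move=> g /andP[gs ng]; rewrite bimon_prod coef_bimon !supp //.
  rewrite degD; case: eqP => [E|]; last by rewrite mulr0.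
  by move: ng; rewrite E eqxx /= eqn_add2l => /negbTE ->; rewrite mulr0.
apply: eq_big => g.
  rewrite [RHS]andbC; rewrite [LHS]andbC; congr (_ && _).
  apply/forallP/pffun_onP.
    move=> h; split => //; apply/supportP => yz.
    by rewrite -topredE /= negbK => w; apply/eqP/(implyP (h yz)).
  case=> /supportP h _ yz; apply/implyP => w; apply/eqP/h.
  by rewrite -topredE /= negbK.
case/and3P => g0 gl gr.
have gs : g \in pffun_on ord0 (fun yz => weight yz != 0%N) predT.
  apply/pffun_onP; split => //; apply/supportP => yz.
  by rewrite -topredE /= negbK => w; apply/eqP/(implyP (forallP g0 yz)).
rewrite bimon_prod coef_bimon !supp //.
rewrite degD (eqP gl) (eqP gr) !eqxx mulr1 [RHS]big_mkcond /=.
apply: eq_bigr => yz _; case: ifP => // /negbFE w.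
by rewrite (eqP (implyP (forallP g0 yz) w)) /= expr0 mulr1 invr1.
Qed.

End CoefExpLog.

(** * Counting pairs of stub sets with disjoint owners *)

Section SetsByFibre.
Variables (T V : finType) (h : T -> V).

Definition fibre v : {set T} := [set t | h t == v].

(** A subset of [T] is the same as a family of subsets of the fibres of [h]. *)
Lemma prod_sum_fibre (S : comNzRingType) (G : V -> {set T} -> S) :
  \prod_v \sum_(B : {set T} | B \subset fibre v) G v B =
  \sum_(A : {set T}) \prod_v G v (A :&: fibre v).
Proof.
rewrite bigA_distr_big_dep /=.
rewrite (reindex_onto (fun A : {set T} => [ffun v => A :&: fibre v])
           (fun f => \bigcup_v f v)) /=; last first.
  move=> f /familyP fP; apply/ffunP => v; rewrite ffunE; apply/finset.setP => t.
  rewrite finset.in_setI; apply/andP/idP.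
    case=> /finset.bigcupP[w _ tw]; have := fintype.subsetP (fP w) _ tw.
    by rewrite !inE => /eqP -> /eqP <-.
  by move=> tv; have := fintype.subsetP (fP v) _ tv; split => //;
    apply/finset.bigcupP; exists v.
apply: eq_big => A; last by move=> _; apply: eq_bigr => v _; rewrite ffunE.
apply/andP; split.
  by apply/familyP => v; rewrite ffunE unfold_in /= finset.subsetIr.
apply/eqP/finset.setP => t; apply/finset.bigcupP/idP => [[v _]|tA].
  by rewrite ffunE inE => /andP[].
by exists (h t) => //; rewrite ffunE !inE tA eqxx.
Qed.

Lemma card_fibres (A : {set T}) : (\sum_v #|A :&: fibre v| = #|A|)%N.
Proof.
rewrite -sum1_card (partition_big h predT) //=; apply: eq_bigr => v _.
by rewrite -sum1_card; apply: eq_bigl => t; rewrite !inE.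
Qed.

End SetsByFibre.

Lemma sum_subsets_card (T : finType) (S : nmodType) (A : {set T}) m
    (g : nat -> S) :
  \sum_(B : {set T} | (B \subset A) && (#|B| <= m)%N) g #|B| =
  \sum_(s < m.+1) g s *+ 'C(#|A|, s).
Proof.
rewrite (partition_big (fun B : {set T} => inord #|B| : 'I_m.+1) predT) //=.
apply: eq_bigr => s _; rewrite -cards_draws -sumr_const; apply: eq_big => B.
  rewrite !inE -andbA; congr (_ && _); apply/andP/idP.
    by case=> Bm /eqP <-; rewrite inordK.
  move=> /eqP Bs; rewrite Bs -ltnS ltn_ord; split => //.
  by apply/eqP/val_inj; rewrite /= inordK.
by case/andP => /andP[_ Bm] /eqP <-; rewrite inordK.
Qed.

Lemma card_stub_fibre (V : finType) (d : V -> nat) v :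
  #|fibre (fun s : stub d => tag s) v| = d v.
Proof.
rewrite -[RHS]card_ord.
have inj : injective (fun k : 'I_(d v) => Tagged (fun v => 'I_(d v)) k).
  by move=> j k /eqP; rewrite eq_Tagged => /eqP.
rewrite -(card_imset _ inj); congr #|pred_of_set _|.
apply/finset.setP => -[w k]; rewrite inE /=; apply/eqP/imsetP.
  by move=> wv; subst w; exists k.
by case=> k' _ /(congr1 tag).
Qed.

Section DisjointPairs.
Variables (F : numFieldType) (V : finType) (dout din : V -> nat) (p q : nat).

Definition disjoint_owners (S : {set stub dout}) (T : {set stub din}) : bool :=
  [forall v, (S :&: fibre (fun s => tag s) v == finset.set0) ||
             (T :&: fibre (fun s => tag s) v == finset.set0)].

Definition disjoint_pairs : {set {set stub dout} * {set stub din}} :=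
  [set ST : {set stub dout} * {set stub din} |
    [&& #|ST.1| == p, #|ST.2| == q & disjoint_owners ST.1 ST.2]].

(** Zero when [s] and [t] are both positive: a vertex that supplied stubs of both
    kinds would make the pair of sets intersect. *)
Definition pair_weight (s t : nat) : {poly {poly F}} :=
  if (s == 0%N) || (t == 0%N) then bimon 1 s (s + t)%N else 0.

(** The factor of a vertex in [vertex_poly]: one of the two subsets is empty, so
    the double sum collapses to its two axes. *)
Lemma sum_pair_weight v :
  \sum_(A : {set stub dout} | A \subset fibre (fun s => tag s) v)
   \sum_(B : {set stub din} | B \subset fibre (fun s => tag s) v)
     (if (#|A| <= p)%N && (#|B| <= q)%N then pair_weight #|A| #|B| else 0) =
  1 + (\sum_(i < p) bimon ('C(dout v, i.+1))%:R i.+1 i.+1 +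
       \sum_(j < q) bimon ('C(din v, j.+1))%:R 0 j.+1).
Proof.
have gn s t n : bimon 1 s t *+ n = bimon n%:R s t :> {poly {poly F}}.
  by rewrite /bimon -mulrnAl -polyCMn -scalerMnl.
transitivity (\sum_(A : {set stub dout} |
    (A \subset fibre (fun s => tag s) v) && (#|A| <= p)%N)
   (\sum_(t < q.+1) pair_weight #|A| t *+ 'C(din v, t))).
  rewrite [RHS]big_mkcondr; apply: eq_bigr => A _.
  rewrite -(card_stub_fibre din) -sum_subsets_card [in RHS]big_mkcondr.
  case: ifP => _ /=; last by rewrite big1.
  by [].
rewrite (sum_subsets_card _ _
  (fun s => \sum_(t < q.+1) pair_weight s t *+ 'C(din v, t))).
rewrite card_stub_fibre big_ord_recl bin0 mulr1n big_ord_recl bin0 mulr1n.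
(* The row [s = 0] and the column [t = 0] share the entry [(0, 0)], which is the
   leading 1. *)
rewrite /pair_weight /= bimon1 -addrA; congr (1 + _); rewrite addrC; congr (_ + _).
  apply: eq_bigr => i _; rewrite /bump /= add1n big_ord_recl bin0 mulr1n /= addn0.
  by rewrite big1 ?addr0 ?gn // => t _; rewrite mul0rn.
by apply: eq_bigr => j _; rewrite /bump /= add1n add0n gn.
Qed.

(** The bounds [p] and [q] at each vertex cost nothing, because no fibre of a
    [p]-set has more than [p] elements. *)
Lemma prod_pair_weight (S : {set stub dout}) (T : {set stub din}) :
  (\prod_v (let A := S :&: fibre (fun s => tag s) v in
            let B := T :&: fibre (fun s => tag s) v in
     if (#|A| <= p)%N && (#|B| <= q)%N
     then pair_weight #|A| #|B| else 0))`_(p + q)`_p =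
  ((S, T) \in disjoint_pairs)%:R.
Proof.
pose A v := S :&: fibre (fun s : stub dout => tag s) v.
pose B v := T :&: fibre (fun s : stub din => tag s) v.
have leA v : (#|A v| <= #|S|)%N by apply/subset_leq_card/finset.subsetIl.
have leB v : (#|B v| <= #|T|)%N by apply/subset_leq_card/finset.subsetIl.
have [/forallP ok|] := boolP [forall v, [&& (#|A v| <= p)%N, (#|B v| <= q)%N &
    (A v == finset.set0) || (B v == finset.set0)]].
  rewrite (eq_bigr (fun v => bimon 1 #|A v| (#|A v| + #|B v|)%N)); last first.
    move=> v _ /=; case/and3P: (ok v) => -> ->.
    by rewrite /pair_weight !cards_eq0 => ->.
  rewrite bimon_prod coef_bimon big1 // mul1r big_split /= !card_fibres.
  congr ((nat_of_bool _)%:R); rewrite inE /=.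
  have -> : disjoint_owners S T.
    by apply/forallP => v; case/and3P: (ok v).
  rewrite andbT; case: eqP => [->|//]; by rewrite eqn_add2l.
rewrite negb_forall => /existsP[v nok].
rewrite (bigD1 v) //= (_ : (if _ then _ else _) = 0); last first.
  move: nok; rewrite negb_and negb_and -/(A v) -/(B v) /pair_weight !cards_eq0.
  by do 2 case: (_ <= _)%N => //=; move=> /negbTE ->.
rewrite mul0r coef0 coef0 (_ : (_ \in _) = false) //; apply/negbTE.
apply: contra nok; rewrite inE => /and3P[/eqP /= Sp /eqP /= Tq /forallP dis].
by rewrite -{1}Sp leA -{1}Tq leB /=; exact: dis.
Qed.

Lemma card_disjoint_pairs :
  (#|disjoint_pairs|)%:R =
  (vertex_poly (fun v (i : 'I_p) => ('C(dout v, i.+1))%:R : F)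
               (fun v (j : 'I_q) => ('C(din v, j.+1))%:R))`_(p + q)`_p.
Proof.
rewrite /vertex_poly; under [in RHS]eq_bigr do rewrite -sum_pair_weight.
rewrite prod_sum_fibre.
under [in RHS]eq_bigr do rewrite prod_sum_fibre.
rewrite pair_big /= coef_sum coef_sum -sum1_card natr_sum big_mkcond /=.
by apply: eq_bigr => -[S T] _; rewrite prod_pair_weight; case: ifP.
Qed.

End DisjointPairs.

(** * Uniform stub assignments *)

Section Assignments.
Variables (T E : finType).

(** List each set followed by its complement, and match the two lists. *)
Lemma exists_bij_sets (S S' : {set T}) : #|S| = #|S'| ->
  exists2 f : T -> T, injective f & forall t, (f t \in S') = (t \in S).
Proof.
move=> SS'; pose s (A : {set T}) := enum A ++ enum (~: A).
have us A : uniq (s A).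
  rewrite cat_uniq !enum_uniq andbT /=; apply/hasPn => t.
  by rewrite !mem_enum inE.
have ss A t : t \in s A by rewrite mem_cat !mem_enum inE; case: (t \in A).
(* The complements have equal size as well, so positions in [S] and in its
   complement correspond to positions in [S'] and in its complement. *)
have szC : #|~: S| = #|~: S'| by apply: (@addnI #|S|); rewrite cardsC SS' cardsC.
have sz : size (s S) = size (s S') by rewrite !size_cat -!cardE SS' szC.
exists (fun t => nth t (s S') (index t (s S))).
  move=> t u; have it t' : (index t' (s S) < size (s S'))%N by rewrite -sz index_mem.
  rewrite (set_nth_default t u) // => /eqP; rewrite nth_uniq // => /eqP e.
  by rewrite -(nth_index t (ss S t)) e nth_index.
move=> t; rewrite index_cat nth_cat mem_enum -cardE -SS'.
have [tS|tS] := boolP (t \in S).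
  have it : (index t (enum S) < #|S|)%N by rewrite cardE index_mem mem_enum.
  by rewrite it -mem_enum mem_nth // -cardE -SS'.
rewrite cardE ltnNge leq_addr /= -cardE addKn; apply/negbTE.
rewrite -finset.in_setC -mem_enum mem_nth // -cardE -szC cardE index_mem mem_enum.
by rewrite inE.
Qed.

Variable delta : E -> nat.

Definition assignments : {set {ffun T -> E}} :=
  [set phi : {ffun T -> E} | [forall e, #|[set s | phi s == e]| == delta e]].

Definition assignments_with (e : E) (S : {set T}) : {set {ffun T -> E}} :=
  [set phi in assignments | [set s | phi s == e] == S].

(** Precomposition with a bijection carrying [S] to [S'] maps the assignments
    that send exactly [S'] to [e] injectively to those that send exactly [S] to
    [e]. *)
Lemma leq_assignments_with e (S S' : {set T}) : #|S| = #|S'| ->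
  (#|assignments_with e S'| <= #|assignments_with e S|)%N.
Proof.
move=> /exists_bij_sets[f fI fS].
pose c (phi : {ffun T -> E}) := [ffun t => phi (f t)].
have [f' fK f'K] := injF_bij fI.
have cI : injective c.
  by move=> phi psi /ffunP h; apply/ffunP => t; have := h (f' t); rewrite !ffunE f'K.
rewrite -(card_imset _ cI); apply: subset_leq_card.
apply/fintype.subsetP => _ /imsetP[phi + ->]; rewrite !inE.
have pre e' : [set s | c phi s == e'] = f @^-1: [set s | phi s == e'].
  by apply/finset.setP => t; rewrite !inE ffunE.
case/andP => /forallP h /eqP hS; apply/andP; split.
  apply/forallP => e'; rewrite pre on_card_preimset //.
  by exists f' => t _.
by rewrite pre hS; apply/eqP/finset.setP => t; rewrite inE.
Qed.

(** By symmetry all [S] of the right size receive the same share of the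
    assignments. *)
Lemma card_assignments e (S : {set T}) : #|S| = delta e ->
  (#|assignments_with e S| * 'C(#|T|, delta e) = #|assignments|)%N.
Proof.
move=> Sd; rewrite -[RHS]sum1_card.
rewrite (partition_big (fun phi : {ffun T -> E} => [set s | phi s == e]%SET)
  (fun A : {set T} => #|A| == delta e)) /=; last first.
  by move=> phi; rewrite inE => /forallP.
rewrite -card_draws mulnC -sum_nat_const; apply: eq_big => [A|A]; rewrite inE //.
move=> /eqP Ad.
transitivity #|assignments_with e A|.
  by apply/anti_leq/andP; split; apply: leq_assignments_with; rewrite Ad Sd.
by rewrite -sum1_card; apply: eq_bigl => phi; rewrite !inE.
Qed.

End Assignments.

(** * Reduction of the infinite sums to a finite box *)

Local Open Scope classical_set_scope.

(** Every infinite sum of the theorem becomes finite in this way: its support is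
    the image of a predicate on a finite type. *)
Lemma fsbig_finType (S : eqType) (idx : S) (op : Monoid.com_law idx)
    (T : finType) (U : choiceType) (h : T -> U) (P : pred T) (A : set U)
    (F : U -> S) :
  injective h -> (forall x, P x -> A (h x)) ->
  (forall u, A u -> F u != idx -> exists2 x, P x & h x = u) ->
  \big[op/idx]_(u \in A) F u = \big[op/idx]_(x | P x) F (h x).
Proof.
move=> hI PA AP; rewrite (@fsbigE _ _ _ _ _ [seq h x | x <- enum P]) //.
- rewrite big_map big_enum_cond /=; apply: eq_bigl => x; apply: andb_idr.
  by move=> Px; rewrite inE; apply: PA.
- by rewrite map_inj_uniq // enum_uniq.
- by move=> u /= /mapP[x]; rewrite mem_enum => Px ->; apply: PA.
- move=> u Au; apply: contraNeq => Fu; have [x Px <-] := AP u Au Fu.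
  by rewrite map_f // mem_enum.
Qed.

Lemma has_nat_sum_ge (T : choiceType) (F : T -> nat) s t :
  has_nat_sum F s -> (F t <= s)%N.
Proof.
case=> Ffin <-.
have [->//|Ft] := eqVneq (F t) 0%N.
rewrite (fsbigTE (fset_set [set t | F t != 0%N])); last first.
  by move=> i; rewrite in_fset_set // notin_setE /= => /negP; rewrite negbK => /eqP.
rewrite (bigD1_seq t) ?fset_uniq //= ?leq_addr //.
by rewrite in_fset_set // inE.
Qed.

Section Box.
Variables (p q K : nat).
Local Notation box := ({ffun 'I_p -> 'I_K.+1} * {ffun 'I_q -> 'I_K.+1})%type.

Definition vec_of_box (d : nat) (y : {ffun 'I_d -> 'I_K.+1}) : vecn d :=
  [ffun i => nat_of_ord (y i)].

Definition pair_of_box (yz : box) : vecn p * vecn q :=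
  (vec_of_box yz.1, vec_of_box yz.2).

(** Extension by zero from the box to all pairs of vectors. *)
Definition extend (g : {ffun box -> 'I_K.+1}) (w : vecn p * vecn q) : nat :=
  \sum_(yz | pair_of_box yz == w) g yz.

Lemma vec_of_box_inj d : injective (@vec_of_box d).
Proof.
move=> y y' /ffunP h; apply/ffunP => i; apply: val_inj.
by have := h i; rewrite !ffunE.
Qed.

Lemma vec_of_box_surj d (a : vecn d) : (forall i, a i <= K)%N ->
  exists y, vec_of_box y = a.
Proof.
move=> aK; exists [ffun i => inord (a i)]; apply/ffunP => i.
by rewrite !ffunE inordK // ltnS.
Qed.

Lemma pair_of_box_inj : injective pair_of_box.
Proof. by move=> [y z] [y' z'] [/vec_of_box_inj -> /vec_of_box_inj ->]. Qed.

Lemma extendE g yz : extend g (pair_of_box yz) = g yz.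
Proof.
rewrite /extend (big_pred1 yz) // => yz'.
by rewrite (inj_eq pair_of_box_inj).
Qed.

Lemma extend_out g w : extend g w != 0%N -> exists yz, pair_of_box yz = w.
Proof.
move=> h; have [yz /eqP e|no] := pickP (fun yz => pair_of_box yz == w).
  by exists yz.
by move: h; rewrite /extend big_pred0.
Qed.

Lemma extend_inj : injective extend.
Proof.
move=> g g' h; apply/ffunP => yz; apply: val_inj.
by rewrite /= -!extendE h.
Qed.

Lemma fsbig_box (S : eqType) (idx : S) (op : Monoid.com_law idx)
    (F : vecn p * vecn q -> nat -> S) (g : {ffun box -> 'I_K.+1}) :
  (forall w, F w 0%N = idx) ->
  \big[op/idx]_(w \in setT) F w (extend g w) =
  \big[op/idx]_yz F (pair_of_box yz) (g yz).
Proof.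
move=> F0; rewrite (fsbig_finType (P := predT) _ pair_of_box_inj) //.
  by apply: eq_bigr => yz _; rewrite extendE.
move=> w _ Fw; have [|yz <-] := @extend_out g w; last by exists yz.
by apply: contraNneq Fw => ->; rewrite F0.
Qed.

(** The finite support demanded by [has_nat_sum] is automatic for functions that
    vanish outside the box. *)
Lemma has_nat_sum_box (c : vecn p * vecn q -> nat) g s :
  has_nat_sum (fun w => c w * extend g w)%N s <->
  (\sum_yz c (pair_of_box yz) * g yz)%N = s.
Proof.
have E : \big[addn/0%N]_(w \in [set: vecn p * vecn q]) (c w * extend g w)%N =
    (\sum_yz c (pair_of_box yz) * g yz)%N.
  by rewrite (fsbig_box _ (F := fun w n => c w * n)%N) // => w; rewrite muln0.
rewrite /has_nat_sum E; split=> [[]//|->]; split => //.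
apply: (@sub_finite_set _ _ (pair_of_box @` [set: box])); last first.
  exact/finite_image/finite_finset.
move=> w /=; rewrite muln_eq0 negb_or => /andP[_ /extend_out[yz <-]].
by exists yz.
Qed.

Definition Rbox (a : {ffun 'I_p -> 'I_K.+1}) (b : {ffun 'I_q -> 'I_K.+1})
    (g : {ffun box -> 'I_K.+1}) : bool :=
  [&& [forall yz, (weight yz == 0%N) ==> (g yz == ord0)],
      [forall i, (\sum_(yz : box) yz.1 i * g yz)%N == a i] &
      [forall j, (\sum_(yz : box) yz.2 j * g yz)%N == b j]].

Lemma weight_eq0 (yz : box) :
  weight yz = 0%N -> pair_of_box yz = ([ffun => 0%N], [ffun => 0%N]).
Proof.
move/eqP; rewrite addn_eq0 !sum_nat_eq0 => /andP[/forallP h1 /forallP h2].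
congr pair; apply/ffunP => i; rewrite !ffunE; first exact/eqP/(h1 i).
exact/eqP/(h2 i).
Qed.

Lemma Rbox_Rhat a b g : Rbox a b g <->
  Rhat (vec_of_box a) (vec_of_box b) (extend g).
Proof.
have E1 i s : has_nat_sum (fun w : vecn p * vecn q => w.1 i * extend g w)%N s <->
   (\sum_(yz : box) yz.1 i * g yz)%N = s.
  rewrite (has_nat_sum_box (fun w : vecn p * vecn q => w.1 i)).
  by under eq_bigr do rewrite ffunE.
have E2 j s : has_nat_sum (fun w : vecn p * vecn q => w.2 j * extend g w)%N s <->
   (\sum_(yz : box) yz.2 j * g yz)%N = s.
  rewrite (has_nat_sum_box (fun w : vecn p * vecn q => w.2 j)).
  by under eq_bigr do rewrite ffunE.
split.
  case/and3P => /forallP h0 /forallP h1 /forallP h2; split.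
  - have -> : ([ffun=> 0%N], [ffun=> 0%N]) =
        pair_of_box ([ffun=> ord0], [ffun=> ord0]).
      by congr pair; apply/ffunP => i; rewrite !ffunE.
    rewrite extendE; apply/eqP/(implyP (h0 _)).
    by rewrite /weight !big1 // => i _; rewrite ffunE.
  - by move=> i; apply/E1; rewrite ffunE; apply/eqP.
  - by move=> j; apply/E2; rewrite ffunE; apply/eqP.
case=> h0 h1 h2; apply/and3P; split; apply/forallP.
- move=> yz; apply/implyP => /eqP/weight_eq0 w0; apply/eqP/val_inj.
  by rewrite /= -extendE w0.
- by move=> i; apply/eqP; have /E1 := h1 i; rewrite ffunE.
- by move=> j; apply/eqP; have /E2 := h2 j; rewrite ffunE.
Qed.

(** If [gamma w] is positive, every coordinate of [w] is at most the matching
    [a i] or [b j], as each product [w.1 i * gamma w] is bounded by the whole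
    sum; and since [w] is not zero, some coordinate bounds [gamma w] as well. *)
Lemma Rhat_bounded a b gamma : Rhat (vec_of_box a) (vec_of_box b) gamma ->
  exists g, extend g = gamma.
Proof.
case=> h0 h1 h2.
have b1 (w : vecn p * vecn q) i : (w.1 i * gamma w <= K)%N.
  apply: leq_trans (has_nat_sum_ge w (h1 i)) _.
  by rewrite ffunE -ltnS.
have b2 (w : vecn p * vecn q) j : (w.2 j * gamma w <= K)%N.
  apply: leq_trans (has_nat_sum_ge w (h2 j)) _.
  by rewrite ffunE -ltnS.
have in_box w : gamma w != 0%N -> exists yz, pair_of_box yz = w.
  move=> gw; have [y ey] : exists y, vec_of_box y = w.1.
    by apply: vec_of_box_surj => i; apply: leq_trans (b1 w i); rewrite leq_pmulr // lt0n.
  have [z ez] : exists z, vec_of_box z = w.2.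
    by apply: vec_of_box_surj => i; apply: leq_trans (b2 w i); rewrite leq_pmulr // lt0n.
  by exists (y, z); rewrite /pair_of_box ey ez; case: (w).
have gK w : (gamma w <= K)%N.
  have [[i wi]|no1] := pselect (exists i, w.1 i != 0%N).
    by apply: leq_trans (b1 w i); rewrite leq_pmull // lt0n.
  have [[j wj]|no2] := pselect (exists j, w.2 j != 0%N).
    by apply: leq_trans (b2 w j); rewrite leq_pmull // lt0n.
  suff -> : w = ([ffun=> 0%N], [ffun=> 0%N]) by rewrite h0.
  case: w no1 no2 => y z /= no1 no2; congr pair; apply/ffunP => i; rewrite ffunE.
    by apply/eqP; apply: contra_notT no1 => yi; exists i.
  by apply/eqP; apply: contra_notT no2 => zi; exists i.
exists [ffun yz => inord (gamma (pair_of_box yz))]; apply/funext => w.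
have [gw|gw] := eqVneq (gamma w) 0%N; last first.
  have [yz <-] := in_box w gw.
  by rewrite extendE ffunE inordK // ltnS.
rewrite gw; apply/eqP; apply: contraT => nz; have [yz e] := extend_out nz.
by move: nz; rewrite -e extendE ffunE e gw inordK.
Qed.

Lemma Rhat_sum (S : nmodType) a b (F : (vecn p * vecn q -> nat) -> S) :
  \sum_(gamma \in Rhat (vec_of_box a) (vec_of_box b)) F gamma =
  \sum_(g | Rbox a b g) F (extend g).
Proof.
apply: fsbig_finType; first exact: extend_inj.
  by move=> g /Rbox_Rhat.
move=> gamma h _; have [g eg] := Rhat_bounded h; exists g => //.
by apply/Rbox_Rhat; rewrite eg.
Qed.

End Box.

Lemma type_vectors_sum (S : nmodType) (p K : nat) (F : vecn p -> S) :
  (p <= K)%N ->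
  \sum_(a \in type_vectors p) F a =
  \sum_(a : {ffun 'I_p -> 'I_K.+1} | (\sum_(i < p) i.+1 * a i == p)%N)
    F (vec_of_box a).
Proof.
move=> pK; apply: fsbig_finType; first exact: vec_of_box_inj.
  move=> a /eqP h; rewrite /type_vectors /= -[RHS]h.
  by apply: eq_bigr => i _; rewrite ffunE.
move=> a /= h _; have [i|y ey] := @vec_of_box_surj K p a.
  apply: leq_trans pK; rewrite -[X in (_ <= X)%N]h (bigD1 i) //=.
  by rewrite (leq_trans _ (leq_addr _ _)) // leq_pmull.
exists y => //; rewrite -[X in _ == X]h -ey; apply/eqP.
by apply: eq_bigr => i _; rewrite ffunE.
Qed.

Lemma factor_rearrange (R : fieldType) (A B s m w y z c : R) n :
  A^-1 ^+ n * B^-1 ^+ n * (s ^+ n * (c^-1 * (m * w / (y * z)) ^+ n)) =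
  c^-1 * (s * w / (y * z) * (m / (A * B))) ^+ n.
Proof.
rewrite [LHS]mulrA -exprMn -exprMn [LHS]mulrCA -exprMn; congr (_ * _ ^+ _).
by rewrite !invfM; move: A^-1 B^-1 y^-1 z^-1 => a b y' z'; ring.
Qed.

Section SumOverBox.
Variables (R : realType) (p q : nat).
Local Notation K := (p + q)%N.
Local Notation box := ({ffun 'I_p -> 'I_K.+1} * {ffun 'I_q -> 'I_K.+1})%type.

Definition total_degree (g : {ffun box -> 'I_K.+1}) : bool :=
  [&& [forall yz, (weight yz == 0%N) ==> (g yz == ord0)],
      (\sum_yz degl yz * g yz == p)%N & (\sum_yz degr yz * g yz == q)%N].

Definition margl (g : {ffun box -> 'I_K.+1}) (i : 'I_p) : nat :=
  (\sum_(yz : box) yz.1 i * g yz)%N.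
Definition margr (g : {ffun box -> 'I_K.+1}) (j : 'I_q) : nat :=
  (\sum_(yz : box) yz.2 j * g yz)%N.

Lemma degl_marg (g : {ffun box -> 'I_K.+1}) :
  (\sum_yz degl yz * g yz = \sum_(i < p) i.+1 * margl g i)%N.
Proof.
under eq_bigr do rewrite /degl big_distrl.
rewrite exchange_big /=; apply: eq_bigr => i _.
by rewrite /margl big_distrr /=; apply: eq_bigr => yz _; rewrite mulnA.
Qed.

Lemma degr_marg (g : {ffun box -> 'I_K.+1}) :
  (\sum_yz degr yz * g yz = \sum_(j < q) j.+1 * margr g j)%N.
Proof.
under eq_bigr do rewrite /degr big_distrl.
rewrite exchange_big /=; apply: eq_bigr => i _.
by rewrite /margr big_distrr /=; apply: eq_bigr => yz _; rewrite mulnA.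
Qed.

Lemma le_weighted_sum n (a : 'I_n -> nat) i : (a i <= \sum_(k < n) k.+1 * a k)%N.
Proof. by rewrite (bigD1 i) //= (leq_trans _ (leq_addr _ _)) // leq_pmull. Qed.

(** The vectors [a] and [b] are the marginals of [g], so that summing over them
    only imposes that the marginals have weighted sums [p] and [q]. *)
Lemma sum_by_type (T : {ffun box -> 'I_K.+1} -> R) :
  \sum_(a : {ffun 'I_p -> 'I_K.+1} | (\sum_(i < p) i.+1 * a i == p)%N)
   \sum_(b : {ffun 'I_q -> 'I_K.+1} | (\sum_(j < q) j.+1 * b j == q)%N)
     \sum_(g | Rbox a b g) T g =
  \sum_(g | total_degree g) T g.
Proof.
pose A (g : {ffun box -> 'I_K.+1}) : {ffun 'I_p -> 'I_K.+1} :=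
  [ffun i => inord (margl g i)].
pose B (g : {ffun box -> 'I_K.+1}) : {ffun 'I_q -> 'I_K.+1} :=
  [ffun j => inord (margr g j)].
have AE g i : total_degree g -> nat_of_ord (A g i) = margl g i.
  case/and3P => _ /eqP gl _; rewrite ffunE inordK // ltnS.
  apply: leq_trans (leq_addr q p).
  by rewrite -[X in (_ <= X)%N]gl degl_marg le_weighted_sum.
have BE g j : total_degree g -> nat_of_ord (B g j) = margr g j.
  case/and3P => _ _ /eqP gr; rewrite ffunE inordK // ltnS.
  apply: leq_trans (leq_addl p q).
  by rewrite -[X in (_ <= X)%N]gr degr_marg le_weighted_sum.
rewrite pair_big /= [RHS](partition_big (fun g => (A g, B g))
  (fun ab => (\sum_(i < p) i.+1 * ab.1 i == p)%N &&
             (\sum_(j < q) j.+1 * ab.2 j == q)%N)) /=;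
  last first.
  move=> g gd; case/and3P: (gd) => _ /eqP gl /eqP gr.
  rewrite -[X in _ == X]gl -[X in _ && (_ == X)]gr degl_marg degr_marg.
  by apply/andP; split; apply/eqP/eq_bigr => i _; rewrite ?AE ?BE.
apply: eq_bigr => -[a b] /= /andP[/eqP ap /eqP bq]; apply: eq_bigl => g.
apply/idP/idP.
  case/and3P => g0 /forallP ga /forallP gb; apply/andP; split.
    apply/and3P; split => //.
      rewrite degl_marg -[X in _ == X]ap; apply/eqP/eq_bigr => i _.
      by rewrite -(eqP (ga i)).
    rewrite degr_marg -[X in _ == X]bq; apply/eqP/eq_bigr => i _.
    by rewrite -(eqP (gb i)).
  apply/eqP; congr pair; apply/ffunP => i; rewrite ffunE; apply: val_inj => /=.
    by rewrite /margl (eqP (ga i)) inordK.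
  by rewrite /margr (eqP (gb i)) inordK.
case/andP => gd /eqP[<- <-]; apply/and3P; split.
- by case/and3P: gd.
- by apply/forallP => i; rewrite AE.
- by apply/forallP => j; rewrite BE.
Qed.

(** Powers with the marginals as exponents are distributed over the terms of
    [g]; in this way the factor [\prod_k k!^(a k)] enters the coefficient of
    each single [(y, z)]. *)
Lemma prod_marg n (c : 'I_n -> R) (m : 'I_n -> nat) (y : box -> 'I_n -> nat)
    (g : {ffun box -> 'I_K.+1}) : (forall k, (\sum_yz y yz k * g yz)%N = m k) ->
  \prod_k c k ^+ m k = \prod_yz (\prod_k c k ^+ y yz k) ^+ g yz.
Proof.
move=> h; under eq_bigr do rewrite -h -prodrXr.
rewrite exchange_big; apply: eq_bigr => yz _; rewrite -prodrXl.
by apply: eq_bigr => k _; rewrite exprM.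
Qed.

Variable M : vecn p * vecn q -> R.

Definition box_factor (yz : box) : R :=
  M (pair_of_box yz) /
  ((\prod_(i < p) i.+1`!%:R ^+ yz.1 i) * \prod_(j < q) j.+1`!%:R ^+ yz.2 j).

(** The sign, the factorials [k!^(a k)], [k!^(b k)] and the moments are gathered
    into one factor for each [(y, z)], of the form that [sum_gamma_coef]
    evaluates. *)
Lemma gamma_sum_box :
  \sum_(a \in type_vectors p)
    (p`!%:R / (\prod_(k < p) k.+1`!%:R ^+ a k) *
    \sum_(b \in type_vectors q)
      (q`!%:R / (\prod_(k < q) k.+1`!%:R ^+ b k) *
      \sum_(gamma \in Rhat a b)
        ((-1) ^+ (\big[addn/0%N]_(gh \in setT) (weight_pred gh * gamma gh)%N) *
        \big[*%R/1]_(yz \in setT)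
          ((gamma yz)`!%:R^-1 *
           (M yz * (weight_pred yz)`!%:R /
            ((\prod_(i < p) (yz.1 i)`!%:R) *
             (\prod_(j < q) (yz.2 j)`!%:R))) ^+ gamma yz)))) =
  p`!%:R * q`!%:R *
  \sum_(g | total_degree g)
    \prod_yz ((g yz)`!%:R^-1 * (log_coef R yz * box_factor yz) ^+ g yz).
Proof.
rewrite (type_vectors_sum _ (leq_addr q p)) mulr_sumr -sum_by_type.
apply: eq_bigr => a /eqP ap.
rewrite (type_vectors_sum _ (leq_addl p q)) mulr_sumr.
apply: eq_bigr => b /eqP bq; rewrite Rhat_sum !mulr_sumr.
apply: eq_bigr => g gR.
rewrite (fsbig_box _ (F := fun w n => (weight_pred w * n)%N)); last first.
  by move=> w; rewrite muln0.
rewrite (fsbig_box _ (F := fun w n => n`!%:R^-1 *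
   (M w * (weight_pred w)`!%:R /
            ((\prod_(i < p) (w.1 i)`!%:R) *
             (\prod_(j < q) (w.2 j)`!%:R))) ^+ n)); last first.
  by move=> w; rewrite expr0 mulr1 invr1.
case/and3P: gR => _ /forallP ga /forallP gb.
rewrite (@prod_marg p _ _ (fun yz k => nat_of_ord (yz.1 k)) g); last first.
  by move=> k; rewrite ffunE (eqP (ga k)).
rewrite (@prod_marg q _ _ (fun yz k => nat_of_ord (yz.2 k)) g); last first.
  by move=> k; rewrite ffunE (eqP (gb k)).
have inv_prod (c : box -> R) :
    (\prod_yz c yz ^+ g yz)^-1 = \prod_yz (c yz)^-1 ^+ g yz.
  by rewrite -prodfV; apply: eq_bigr => yz _; rewrite exprVn.
rewrite !inv_prod -prodrXr.
rewrite mulrA [X in X * _]mulrACA -[LHS]mulrA; congr (_ * _).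
rewrite -!big_split /=; apply: eq_bigr => yz _.
have -> : weight_pred (pair_of_box yz) = (weight yz).-1.
  rewrite /weight_pred /weight; congr (_ + _).-1;
  by apply: eq_bigr => i _; rewrite ffunE.
rewrite exprM /log_coef /box_factor.
under [\prod_(i < p) (_ `!)%:R]eq_bigr do rewrite ffunE.
under [\prod_(i < q) (_ `!)%:R]eq_bigr do rewrite ffunE.
exact: factor_rearrange.
Qed.

End SumOverBox.

(** * The expected number of weak self-loops *)

Lemma card_stub (V : finType) (d : V -> nat) : #|stub d| = (\sum_v d v)%N.
Proof.
rewrite -cardsT -(card_fibres (fun s : stub d => tag s)).
by apply: eq_bigr => v _; rewrite finset.setTI card_stub_fibre.
Qed.
(** When the degrees agree in total, the stubs are in bijection with the slots
    of the hyperedges, and every stub goes to the hyperedge of its slot. *)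
Lemma assignments_gt0 (T E : finType) (delta : E -> nat) :
  #|T| = (\sum_e delta e)%N -> (0 < #|assignments T delta|)%N.
Proof.
rewrite -card_stub => TE; apply/card_gt0P.
pose f t : stub delta := enum_val (cast_ord TE (enum_rank t)).
pose f' (s : stub delta) : T := enum_val (cast_ord (esym TE) (enum_rank s)).
have fK : cancel f f' by move=> t; rewrite /f /f' enum_valK cast_ordK enum_rankK.
have f'K : cancel f' f by move=> t; rewrite /f /f' enum_valK cast_ordKV enum_rankK.
exists [ffun t => tag (f t)]; rewrite inE; apply/forallP => e.
rewrite -(card_stub_fibre delta e) -(on_card_preimset (f := f)).
  by apply/eqP; congr #|pred_of_set _|; apply/finset.setP => t; rewrite !inE ffunE.
by exists f' => ? _.
Qed.

Section WeakSelfLoops.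
Variables (R : realType) (V E : finType).
Variables (dout din : V -> nat) (dtail dhead : E -> nat).

Lemma mem_stub_owners (d : V -> nat) (phi : {ffun stub d -> E}) e v :
  (v \in stub_owners phi e) =
  ([set s | phi s == e]%SET :&: fibre (fun s => tag s) v != finset.set0)%SET.
Proof.
rewrite /stub_owners.
have -> s : (v \in seq_mset s) = (v \in s).
  by rewrite -(perm_mem (perm_eq_seq_mset s)).
apply/mapP/finset.set0Pn => [[s]|[s]].
  by rewrite mem_enum inE => se ->; exists s; rewrite !inE se eqxx.
by rewrite !inE => /andP[se /eqP <-]; exists s => //; rewrite mem_enum inE.
Qed.

Lemma no_weak_self_loop (H : stub_hypergraph E dout din) e :
  ~~ weak_self_loop H e =
  disjoint_owners [set s | H.1 s == e]%SET [set s | H.2 s == e]%SET.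
Proof.
rewrite /weak_self_loop negb_exists; apply: eq_forallb => v.
by rewrite !mem_stub_owners negb_and !negbK.
Qed.

Local Notation HH := (stub_hypergraphs dout din dtail dhead).

(** Sort the hypergraphs by the stub sets of the tail and the head of [e]; each
    admissible pair of sets has the same number of hypergraphs above it. *)
Lemma card_no_weak_self_loop e :
  (#|[set H in HH | ~~ weak_self_loop H e]%SET| *
     ('C(#|stub dout|, dtail e) * 'C(#|stub din|, dhead e)) =
   #|disjoint_pairs dout din (dtail e) (dhead e)| * #|HH|)%N.
Proof.
rewrite cardsX -sum1_card.
pose P1 (phi : {ffun stub dout -> E}) := [set s | phi s == e]%SET.
pose P2 (phi : {ffun stub din -> E}) := [set s | phi s == e]%SET.
rewrite (partition_big (fun H : stub_hypergraph E dout din => (P1 H.1, P2 H.2))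
  (mem (disjoint_pairs dout din (dtail e) (dhead e)))) /=; last first.
  move=> H; rewrite !inE no_weak_self_loop.
  case/andP => /andP[/forallP h1 /forallP h2] h3.
  by rewrite h1 h2.
rewrite big_distrl /= -sum_nat_const; apply: eq_bigr => -[S T].
rewrite inE /= => /and3P[/eqP Sp /eqP Tq dis].
rewrite -(card_assignments Sp) -(card_assignments Tq) mulnACA.
congr (_ * _)%N; rewrite -cardsX -sum1_card; apply: eq_bigl => -[phi psi].
rewrite !inE no_weak_self_loop /= xpair_eqE.
rewrite [LHS]andbC -andbA; apply/andP/andP.
  case=> /eqP h1 /andP[/eqP h2 /andP[/andP[a1 a2] _]].
  by rewrite a1 a2 -h1 -h2 !eqxx.
case=> /andP[a1 /eqP h1] /andP[a2 /eqP h2].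
by rewrite a1 a2 /P1 /P2 h1 h2 !eqxx.
Qed.

Lemma expect_WS :
  (0 < #|HH|)%N ->
  unif_expect HH (fun H => (WS H)%:R) = #|E|%:R -
  \sum_(e : E) (#|[set H in HH | ~~ weak_self_loop H e]%SET|)%:R / #|HH|%:R :> R.
Proof.
move=> H0; rewrite /unif_expect.
have Hn0 : (#|HH|)%:R != 0 :> R by rewrite pnatr_eq0 -lt0n.
apply: (mulIf Hn0); rewrite divfK // mulrBl mulr_suml.
under [in RHS]eq_bigr do rewrite divfK //.
rewrite -natrM -natr_sum -natr_sum.
apply/eqP; rewrite eq_sym subr_eq -natrD eqr_nat; apply/eqP.
under [X in (_ + X)%N]eq_bigr do rewrite -sum1_card.
transitivity (\sum_(H in HH) #|E|)%N; first by rewrite sum_nat_const mulnC.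
have -> : (\sum_(e : E) \sum_(H in [set H in HH | ~~ weak_self_loop H e]%SET) 1 =
   \sum_(H in HH) #|[set e | ~~ weak_self_loop H e]%SET|)%N.
  under [RHS]eq_bigr do rewrite -sum1_card.
  rewrite [RHS](exchange_big_dep predT) //=; apply: eq_bigr => e _.
  by apply: eq_bigl => H; rewrite !inE.
rewrite -big_split /=; apply: eq_bigr => H _.
rewrite -[LHS](cardsC [set e | weak_self_loop H e]%SET) /WS.
congr (_ + #|pred_of_set _|)%N.
by apply/finset.setP => e; rewrite !inE.
Qed.

End WeakSelfLoops.

(** Also for empty [V], where the expectation is a division by zero. *)
Lemma card_unif_expect (R : realType) (V : finType) (X : V -> R) :
  #|V|%:R * unif_expect [set: V]%SET X = \sum_v X v.
Proof.
rewrite /unif_expect cardsT; have [V0|Vn0] := eqVneq #|V| 0%N.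
  rewrite V0 mul0r big_pred0 // => v; have := max_card (pred1 v).
  by rewrite card1 V0.
rewrite mulrC divfK ?pnatr_eq0 //.
by apply: eq_bigl => v; rewrite inE.
Qed.

Lemma rfact_nat (R : realType) n : rfact (n%:R : R) = n`!%:R.
Proof. by rewrite /rfact natrK. Qed.

(** The factorial [i!] needed here is the one that [k!^(a k)] supplies. *)
Lemma ff_bin (R : realType) u i : ff R u i / i`!%:R = 'C(u, i)%:R.
Proof.
rewrite /ff; case: leqP => [iu|ui]; last by rewrite mul0r bin_small.
rewrite -(bin_fact iu) !natrM.
by rewrite mulrA mulfK ?mulfK // pnatr_eq0 -lt0n fact_gt0.
Qed.

(** The sums over [a], [b] and [gamma] of the theorem count ordered selections:
    their value is [p! q!] times the number of pairs of disjointly owned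
    sets. *)
Lemma disjoint_pairs_formula (R : realType) (V : finType) (dout din : V -> nat) p q :
  let EU : (V -> R) -> R := unif_expect [set: V]%SET in
    \sum_(a \in type_vectors p)
      (p`!%:R / (\prod_(k < p) k.+1`!%:R ^+ a k) *
      \sum_(b \in type_vectors q)
        (q`!%:R / (\prod_(k < q) k.+1`!%:R ^+ b k) *
        \sum_(gamma \in Rhat a b)
          ((-1) ^+ (\big[addn/0%N]_(gh \in setT) (weight_pred gh * gamma gh)%N) *
          \big[*%R/1]_(yz \in setT)
            ((gamma yz)`!%:R^-1 *
             (#|V|%:R * EU (fun u => (\prod_(i < p) ff R (dout u) i.+1 ^+ yz.1 i) *
                               (\prod_(j < q) ff R (din u) j.+1 ^+ yz.2 j)) *
              (weight_pred yz)`!%:R /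
              ((\prod_(i < p) (yz.1 i)`!%:R) *
               (\prod_(j < q) (yz.2 j)`!%:R))) ^+ gamma yz)))) =
  p`!%:R * q`!%:R * #|disjoint_pairs dout din p q|%:R.
Proof.
move=> EU.
rewrite (gamma_sum_box (fun yz : vecn p * vecn q => #|V|%:R *
  EU (fun u => (\prod_(i < p) ff R (dout u) i.+1 ^+ yz.1 i) *
               (\prod_(j < q) ff R (din u) j.+1 ^+ yz.2 j)))).
congr (_ * _); rewrite card_disjoint_pairs -sum_gamma_coef.
apply: eq_bigr => g _; apply: eq_bigr => yz _; congr (_ * (_ * _) ^+ _).
rewrite /box_factor card_unif_expect /vertex_sum mulr_suml.
apply: eq_bigr => v _; rewrite invfM mulrACA -!prodfV -!big_split /=.
by congr (_ * _); apply: eq_bigr => i _; rewrite ffunE -exprVn -exprMn ff_bin.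
Qed.

Theorem theorem6 (R : realType) (V E : finType)
    (dout din : V -> nat) (dtail dhead : E -> nat)
    (hout : (\sum_v dout v)%N = (\sum_e dtail e)%N)
    (hin : (\sum_v din v)%N = (\sum_e dhead e)%N) :
  let n : R := #|V|%:R in
  let EU : (V -> R) -> R := unif_expect [set: V]%SET in
  unif_expect (stub_hypergraphs dout din dtail dhead) (fun H => (WS H)%:R) =
  #|E|%:R -
  \sum_(e : E)
    rfact (n * EU (fun u => (dout u)%:R) - (dtail e)%:R) *
    rfact (n * EU (fun u => (din u)%:R) - (dhead e)%:R) /
    (rfact (n * EU (fun u => (dout u)%:R)) *
     rfact (n * EU (fun u => (din u)%:R))) *
    \sum_(a \in type_vectors (dtail e))
      ((dtail e)`!%:R / (\prod_(k < dtail e) k.+1`!%:R ^+ a k) *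
      \sum_(b \in type_vectors (dhead e))
        ((dhead e)`!%:R / (\prod_(k < dhead e) k.+1`!%:R ^+ b k) *
        \sum_(gamma \in Rhat a b)
          ((-1) ^+ (\big[addn/0%N]_(gh \in setT) (weight_pred gh * gamma gh)%N) *
          \big[*%R/1]_(yz \in setT)
            ((gamma yz)`!%:R^-1 *
             (n * EU (fun u => (\prod_(i < dtail e) ff R (dout u) i.+1 ^+ yz.1 i) *
                               (\prod_(j < dhead e) ff R (din u) j.+1 ^+ yz.2 j)) *
              (weight_pred yz)`!%:R /
              ((\prod_(i < dtail e) (yz.1 i)`!%:R) *
               (\prod_(j < dhead e) (yz.2 j)`!%:R))) ^+ gamma yz)))).
Proof.
move=> n EU.
have HH0 : (0 < #|stub_hypergraphs dout din dtail dhead|)%N.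
  by rewrite cardsX muln_gt0 !assignments_gt0 // card_stub.
rewrite expect_WS //; congr (_ - _); apply: eq_bigr => e _.
rewrite disjoint_pairs_formula !card_unif_expect -!natr_sum.
have le_p : (dtail e <= \sum_v dout v)%N by rewrite hout (bigD1 e) //= leq_addr.
have le_q : (dhead e <= \sum_v din v)%N by rewrite hin (bigD1 e) //= leq_addr.
rewrite -!natrB // !rfact_nat -!natrM.
have h := card_no_weak_self_loop dout din dtail dhead e.
rewrite !card_stub in h.
apply/eqP; rewrite mulrAC eqr_div ?pnatr_eq0 -?lt0n ?muln_gt0 ?fact_gt0 //.
rewrite -!natrM eqr_nat; apply/eqP.
rewrite -(bin_fact le_p) -(bin_fact le_q).
set N := #|_| in h *; set D := #|_| in h *; set HN := #|_| in h *.
(* The factorials recombine with the binomial coefficients. *)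
transitivity ((N * ('C(\sum_v dout v, dtail e) * 'C(\sum_v din v, dhead e))) *
  ((dtail e)`! * (\sum_v dout v - dtail e)`! *
   ((dhead e)`! * (\sum_v din v - dhead e)`!)))%N.
  by ring.
by rewrite h; ring.
Qed.
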